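(* Let $k\ge 1$ and $r\ge 1$ be integers, let $G_1,\dots,G_k$ be connected graphs, and let $n_1,\dots,n_r$ be positive integers. Let $\gamma=R(G_1,\dots,G_k)$ and $\kappa=R(K_{n_1},\dots,K_{n_r})$. If $R(G_1,\dots,G_k,K_\kappa)=(\gamma-1)(\kappa-1)+1$, then \[ R(G_1,\dots,G_k,K_{n_1},\dots,K_{n_r})=(\gamma-1)(\kappa-1)+1 . \]
   Context: For graphs $H_1,\dots,H_m$, the (multicolored) Ramsey number $R(H_1,\dots,H_m)$ is the smallest positive integer $p$ such that for every partition $(E_1,\dots,E_m)$ of the edge set of the complete graph $K_p$ (i.e. every edge coloring of $K_p$ with colors $1,\dots,m$), there is some $i$ for which the subgraph formed by the edges of $E_i$ contains a subgraph isomorphic to $H_i$. $K_t$ denotes the complete graph on $t$ vertices. *)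

(* Defs.v *)
From mathcomp Require Import all_boot.

Set Implicit Arguments.
Unset Strict Implicit.
Unset Printing Implicit Defensive.

Record sgraph := SGraph {
  vertex :> finType;
  adj : rel vertex;
  adj_sym : symmetric adj;
  adj_irrefl : irreflexive adj }.

(* The graph with no vertices is not connected. *)
Definition connected (G : sgraph) : bool :=
  (0 < #|G|) && [forall x : G, forall y : G, connect (@adj G) x y].

Lemma complete_sym n : symmetric (fun x y : 'I_n => x != y).
Proof. by move=> x y; rewrite eq_sym. Qed.

Lemma complete_irrefl n : irreflexive (fun x y : 'I_n => x != y).
Proof. by move=> x; rewrite eqxx. Qed.

Definition complete (n : nat) : sgraph :=
  SGraph (@complete_sym n) (@complete_irrefl n).

(* G has a subgraph, not necessarily induced, isomorphic to H: the image of an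
   injective homomorphism from H to G. *)
Definition contains (G H : sgraph) : bool :=
  [exists f : {ffun H -> G},
     injectiveb f && [forall x, forall y, adj x y ==> adj (f x) (f y)]].

Notation edge p := {e : {set 'I_p} | #|e| == 2}.

Section ColorClass.
Variables (m p : nat) (c : {ffun edge p -> 'I_m}) (i : 'I_m).

Definition class_adj : rel 'I_p :=
  fun x y => [exists e : edge p, (val e == [set x; y]) && (c e == i)].

Lemma class_adj_sym : symmetric class_adj.
Proof. by move=> x y; apply: eq_existsb => e; rewrite setUC. Qed.

Lemma class_adj_irrefl : irreflexive class_adj.
Proof.
move=> x; apply/existsP => -[[e /= He] /andP[/eqP De _]].
by move: He; rewrite De setUid cards1.
Qed.

(* The spanning subgraph of K_p whose edges are those of color i. It keeps
   isolated vertices, so it contains K_1 as soon as p > 0. *)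
Definition color_class : sgraph := SGraph class_adj_sym class_adj_irrefl.
End ColorClass.

(* A partition (E_1, ..., E_m) of the edge set of K_p, in which some parts may
   be empty, is given as the map sending each edge to the index of its part. *)
Definition arrows (m : nat) (H : 'I_m -> sgraph) (p : nat) : bool :=
  [forall c : {ffun edge p -> 'I_m},
     exists i, contains (color_class c i) (H i)].

Lemma ramsey_clique m (n : 'I_m -> nat) :
  exists N, forall (T : finType) (col : T -> T -> 'I_m) (S : {set T}),
    (forall x y, col x y = col y x) -> N <= #|S| ->
    exists i (A : {set T}), [/\ A \subset S, #|A| = n i &
      forall x y, x \in A -> y \in A -> x != y -> col x y = i].
Proof.
have [s] := ubnP (\sum_i n i); elim: s n => // s IHs n le_n_s.
have [/existsP[i /eqP ni0] | /existsPn n_gt0] := boolP [exists i, n i == 0].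
  exists 0 => T col S _ _; exists i, set0; rewrite sub0set cards0 ni0.
  by split=> // x y; rewrite inE.
pose n' i j := n j - (j == i).
have lt_n' i : \sum_j n' i j < s.
  move: le_n_s; rewrite ltnS; apply: leq_trans.
  rewrite (bigD1 i) //= [X in _ < X](bigD1 i) //= /n' eqxx.
  rewrite (eq_bigr n) => [|j /negPf->]; last by rewrite subn0.
  by rewrite -addSn leq_add2r subn1 prednK // lt0n n_gt0.
pose Q i N := forall (T : finType) (col : T -> T -> 'I_m) (S : {set T}),
    (forall x y, col x y = col y x) -> N <= #|S| ->
    exists j (A : {set T}), [/\ A \subset S, #|A| = n' i j &
      forall x y, x \in A -> y \in A -> x != y -> col x y = j].
have /fin_all_exists[N HN] : forall i, exists N, Q i N.
  by move=> i; apply: IHs (lt_n' i).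
exists (1 + \sum_i N i) => T col S colC leS.
have /card_gt0P[v Sv] : 0 < #|S| by apply: leq_trans leS.
pose P i := [set x in S :\ v | col v x == i].
have /existsP[i leNi] : [exists i, N i <= #|P i|].
  apply: contraLR leS => /existsPn ltP; rewrite -ltnNge.
  rewrite (cardsD1 v) Sv ltn_add2l -sum1_card (partition_big (col v) predT) //=.
  have leP (i : 'I_m) : true -> #|P i| <= N i by rewrite ltnW // ltnNge ltP.
  have eP (i : 'I_m) : true -> \sum_(x in S :\ v | col v x == i) 1 = #|P i|.
    by move=> _; rewrite -sum1_card; apply: eq_bigl => x; rewrite [RHS]inE.
  rewrite (eq_bigr _ eP) (bigD1 (col v v)) //= [X in _ < X](bigD1 (col v v)) //=.
  rewrite -addSn leq_add //; first by rewrite ltnNge ltP.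
  by apply: leq_sum => j _; apply: leP.
have [j [A [sAP cA monoA]]] := HN i T col (P i) colC leNi.
have sPS : P i \subset S by apply/subsetP=> x; rewrite !inE => /andP[/andP[]].
have [eji | nji] := eqVneq j i; last first.
  exists j, A; split=> //; first exact: subset_trans sPS.
  by rewrite cA /n' (negPf nji) subn0.
rewrite {j}eji in cA monoA; exists i, (v |: A); split.
- by rewrite subUset sub1set Sv (subset_trans sAP).
- have nAv : v \notin A by apply/negP=> /(subsetP sAP); rewrite !inE eqxx.
  by rewrite cardsU1 nAv cA /n' eqxx subnKC // lt0n n_gt0.
have colv x : x \in A -> col v x = i.
  by move/(subsetP sAP); rewrite !inE => /andP[_ /eqP].
move=> x y /setU1P[->|Ax] /setU1P[->|Ay]; first by rewrite eqxx.
- by move=> _; apply: colv.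
- by move=> _; rewrite colC; apply: colv.
exact: monoA.
Qed.

Lemma ramsey_exists m (H : 'I_m -> sgraph) :
  exists p, (0 < p) && arrows H p.
Proof.
case: m H => [|m] H.
  exists 2; apply/forallP=> c.
  have e2 : #|[set: 'I_2]| == 2 by rewrite cardsT card_ord.
  by case: (c (exist (fun e : {set 'I_ _} => #|e| == 2) _ e2)).
have [N HN] := ramsey_clique (fun i => #|H i|).
exists N.+1; apply/forallP=> c.
pose col (x y : 'I_N.+1) := oapp c ord0 (insub [set x; y]).
have colC x y : col x y = col y x by rewrite /col setUC.
have [||i [A [_ cA monoA]]] := HN _ col [set: 'I_N.+1] => //.
  by rewrite cardsT card_ord.
apply/existsP; exists i; apply/existsP.
pose f (x : H i) : 'I_N.+1 := enum_val (cast_ord (esym cA) (enum_rank x)).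
have f_inj : injective f.
  by move=> x y /enum_val_inj /cast_ord_inj /enum_rank_inj.
exists [ffun x => f x]; apply/andP; split.
  by apply/injectiveP=> x y; rewrite !ffunE => /f_inj.
apply/'forall_forallP=> x y; apply/implyP=> xy; rewrite !ffunE.
have nfxy : f x != f y.
  by apply: contraTneq xy => /f_inj->; rewrite adj_irrefl.
have e2 : #|[set f x; f y]| == 2 by rewrite cards2 nfxy.
apply/existsP; exists (exist (fun e : {set 'I_ _} => #|e| == 2) _ e2); rewrite eqxx /=; apply/eqP.
rewrite -(monoA (f x) (f y)) ?enum_valP //.
by rewrite /col insubT.
Qed.

(* The Ramsey number R(H_1, ..., H_m). *)
Definition ramsey (m : nat) (H : 'I_m -> sgraph) : nat :=
  ex_minn (ramsey_exists H).

(* The concatenation H_1, ..., H_m, H'_1, ..., H'_m' of two lists of graphs. *)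
Definition cat_graphs (m m' : nat) (H : 'I_m -> sgraph) (H' : 'I_m' -> sgraph)
    (i : 'I_(m + m')) : sgraph :=
  match split i with inl j => H j | inr j => H' j end.

(* Main.v *)
Require Import Defs.
From mathcomp Require Import all_boot.

Set Implicit Arguments.
Unset Strict Implicit.
Unset Printing Implicit Defensive.

(** Merging the last r colors turns an edge coloring into one for
    (G_1, ..., G_k, K_kappa), and inside a merged K_kappa the r original colors
    yield some K_{n_j}: this bounds the Ramsey number from above.  For the lower
    bound, blow up an extremal r-coloring of K_{kappa-1}, replacing each vertex
    by a copy of K_{gamma-1} with an extremal k-coloring: a monochromatic
    connected G_i stays inside one copy, and a monochromatic K_{n_j} meets
    every copy at most once. *)

(** Colorings as functions of ordered pairs over any type are easy to restrict, merge and blow up.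
    Adjacent vertices have distinct images, so [col] is only read off the diagonal. *)
Definition mono_copy (m : nat) (T : Type) (col : T -> T -> 'I_m)
    (H : sgraph) (i : 'I_m) :=
  exists2 f : H -> T, injective f & forall x y, adj x y -> col (f x) (f y) = i.

(** Pull [col] back along an injection of ['I_p] into [T]. Allowing [p] below the size of [T] also
    makes arrowing monotone. *)
Lemma arrows_mono_copy m p (H : 'I_m -> sgraph) (T : finType)
    (col : T -> T -> 'I_m) :
  arrows H p -> p <= #|T| -> (forall x y, col x y = col y x) ->
  exists i, mono_copy col (H i) i.
Proof.
move=> /forallP arrH le_pT colC.
pose h (x : 'I_p) : T := enum_val (widen_ord le_pT x).
have h_inj : injective h.
  by move=> x y /enum_val_inj /(congr1 val) /= exy; apply: val_inj.
(* An edge is an unordered pair; symmetry of [col] makes its color independent of the order of its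
   ends. *)
have /fin_all_exists[c cP] : forall e : edge p, exists i : 'I_m,
    forall x y, val e = [set x; y] -> col (h x) (h y) = i.
  case=> e e2; have /cards2P[x [y [nxy De]]] := e2.
  exists (col (h x) (h y)) => u v /= /setP Exy.
  have := Exy y; have := Exy x; rewrite De !inE !eqxx orbT.
  move=> /esym/orP[]/eqP xE /esym/orP[]/eqP yE; move: nxy;
    by rewrite xE yE ?eqxx.
have /existsP[i /existsP[f /andP[/injectiveP f_inj /'forall_forallP fP]]] :=
  arrH (finfun c).
exists i, (h \o f) => [|x y xy /=]; first exact: inj_comp.
have /existsP[e /andP[/eqP De /eqP ce]] := implyP (fP x y) xy.
by rewrite (cP e _ _ De) -[RHS]ce ffunE.
Qed.

Lemma not_arrows_coloring m p (H : 'I_m -> sgraph) (i0 : 'I_m) :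
  ~~ arrows H p ->
  exists2 col : 'I_p -> 'I_p -> 'I_m, forall x y, col x y = col y x &
    forall i, ~ mono_copy col (H i) i.
Proof.
rewrite negb_forall => /existsP[c /existsPn badc].
(* [insub] fails only on the diagonal, where [i0] serves as filler. *)
exists (fun x y => oapp c i0 (insub [set x; y])) => [x y|i [f f_inj fP]].
  by rewrite setUC.
case/negP: (badc i); apply/existsP; exists (finfun f).
apply/andP; split; first by apply/injectiveP=> x y; rewrite !ffunE => /f_inj.
apply/'forall_forallP=> x y; apply/implyP=> xy; rewrite !ffunE.
have e2 : #|[set f x; f y]| == 2.
  rewrite cards2 (_ : f x != f y) //.
  by apply: contraTneq xy => /f_inj->; rewrite adj_irrefl.
apply/existsP; exists (exist (fun e : {set 'I_p} => #|e| == 2) _ e2).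
by rewrite eqxx /=; apply/eqP; rewrite -(fP x y xy) insubT.
Qed.

Lemma ramseyP m (H : 'I_m -> sgraph) : 0 < ramsey H /\ arrows H (ramsey H).
Proof. by rewrite /ramsey; case: ex_minnP => p /andP[]. Qed.

Lemma ramsey_le m (H : 'I_m -> sgraph) p :
  0 < p -> arrows H p -> ramsey H <= p.
Proof.
by rewrite /ramsey; case: ex_minnP => q _ min_q p0 Hp; rewrite min_q ?p0.
Qed.

Lemma not_arrows_lt_ramsey m (H : 'I_m -> sgraph) p :
  0 < p -> p < ramsey H -> ~~ arrows H p.
Proof. by move=> p0; rewrite ltnNge; apply: contra; apply: ramsey_le. Qed.

Lemma cat_graphs_lshift m m' (H : 'I_m -> sgraph) (H' : 'I_m' -> sgraph) i :
  cat_graphs H H' (lshift m' i) = H i.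
Proof. by rewrite /cat_graphs (unsplitK (inl i)). Qed.

Lemma cat_graphs_rshift m m' (H : 'I_m -> sgraph) (H' : 'I_m' -> sgraph) i :
  cat_graphs H H' (rshift m i) = H' i.
Proof. by rewrite /cat_graphs (unsplitK (inr i)). Qed.

Lemma arrows_cat_merge k r (j0 : 'I_r) (G : 'I_k -> sgraph)
    (K : 'I_r -> sgraph) q p :
  arrows K q -> arrows (cat_graphs G (fun _ : 'I_1 => complete q)) p ->
  arrows (cat_graphs G K) p.
Proof.
move=> arrK arrG; apply: contraT => /(not_arrows_coloring (rshift k j0)).
case=> col colC bad.
pose merged x y : 'I_(k + 1) :=
  match split (col x y) with inl i => lshift 1 i | inr _ => rshift k ord0 end.
have [|x y|i] := arrows_mono_copy (col := merged) arrG; first by rewrite card_ord.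
  by rewrite /merged colC.
case: (split_ordP i) => {}i ->.
  rewrite cat_graphs_lshift => -[f f_inj fP]; case: (bad (lshift r i)).
  rewrite cat_graphs_lshift; exists f => // x y /fP; rewrite /merged.
  case: split_ordP => j -> /eqP; first by rewrite eq_lshift => /eqP->.
  by rewrite eq_rlshift.
rewrite cat_graphs_rshift => -[f f_inj fP].
(* Pairs of distinct vertices of the merged clique have one of the last [r] colors, so the default
   [j0] arises only on the diagonal. *)
pose inner x y := if split (col (f x) (f y)) is inr j then j else j0.
have [|x y|j [g g_inj gP]] := arrows_mono_copy (col := inner) arrK.
- by rewrite card_ord.
- by rewrite /inner colC.
case: (bad (rshift k j)); rewrite cat_graphs_rshift.
exists (f \o g) => [|x y xy /=]; first exact: inj_comp.
have ngxy : g x != g y.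
  by apply: contraTneq xy => /g_inj->; rewrite adj_irrefl.
have := gP x y xy; have := fP (g x) (g y) ngxy; rewrite /merged /inner.
case: split_ordP => l -> /eqP; first by rewrite eq_lrshift.
by move=> _ ->.
Qed.

Lemma not_arrows_cat_blowup k r (i0 : 'I_k) (j0 : 'I_r) (G : 'I_k -> sgraph)
    (n : 'I_r -> nat) a b p :
  (forall i, connected (G i)) -> ~~ arrows G a ->
  ~~ arrows (fun j => complete (n j)) b -> p <= a * b ->
  ~~ arrows (cat_graphs G (fun j => complete (n j))) p.
Proof.
move=> Gconn /(not_arrows_coloring i0)[colG colGC badG].
move=> /(not_arrows_coloring j0)[colK colKC badK] le_p; apply/negP => arrp.
(* [u.2] names the copy containing [u], and [u.1] its position there. *)
pose col (u v : 'I_a * 'I_b) : 'I_(k + r) :=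
  if u.2 == v.2 then lshift r (colG u.1 v.1) else rshift k (colK u.2 v.2).
have [|u v|i] := arrows_mono_copy (col := col) arrp; first by rewrite card_prod !card_ord.
  by rewrite /col eq_sym colGC colKC.
case: (split_ordP i) => {}i ->.
  rewrite cat_graphs_lshift => -[f f_inj fP].
  have f_edge x y : adj x y ->
      (f x).2 = (f y).2 /\ colG (f x).1 (f y).1 = i.
    move/fP; rewrite /col; case: eqP => [-> | _] /eqP.
      by rewrite eq_lshift => /eqP.
    by rewrite eq_rlshift.
  have f2 x y : (f x).2 = (f y).2.
    have /andP[_ /'forall_forallP/(_ x y) xy] := Gconn i.
    (* Lying in the same copy as [x] is preserved along edges of [G i], so connectedness spreads it
       to every vertex; the first projection is then injective on the image. *)
    have cl : closed (@adj (G i)) [pred z | (f x).2 == (f z).2].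
      by move=> u v /f_edge[uv _]; rewrite !inE uv.
    by have := closed_connect cl xy; rewrite !inE eqxx => /esym/eqP.
  case: (badG i); exists (fun x => (f x).1) => [x y fxy|x y /f_edge[] //].
  by apply: f_inj; rewrite [f x]surjective_pairing fxy (f2 x y) -surjective_pairing.
rewrite cat_graphs_rshift => -[f f_inj fP].
have f_edge x y : x != y -> (f x).2 != (f y).2 /\ colK (f x).2 (f y).2 = i.
  move/fP; rewrite /col; case: eqP => [_ | _] /eqP; first by rewrite eq_lrshift.
  by rewrite eq_rshift => /eqP.
case: (badK i); exists (fun x => (f x).2) => [x y fxy|x y /f_edge[] //].
(* Distinct vertices of a complete graph are adjacent, hence land in different copies. *)
by apply: contra_eq fxy => /f_edge[].
Qed.

Unset Implicit Arguments.

Theorem theorem2 (k r : nat) (hk : 1 <= k) (hr : 1 <= r)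
    (G : 'I_k -> sgraph) (n : 'I_r -> nat)
    (hG : forall i, connected (G i)) (hn : forall j, 0 < n j) :
  let gamma := ramsey G in
  let kappa := ramsey (fun j => complete (n j)) in
  ramsey (cat_graphs G (fun _ : 'I_1 => complete kappa))
    = (gamma - 1) * (kappa - 1) + 1 ->
  ramsey (cat_graphs G (fun j => complete (n j)))
    = (gamma - 1) * (kappa - 1) + 1.
Proof.
move=> gamma kappa Rmerged; pose i0 := Ordinal hk; pose j0 := Ordinal hr.
apply/eqP; rewrite eqn_leq; apply/andP; split.
  rewrite -Rmerged; have [R0 arrR] :=
    ramseyP (cat_graphs G (fun _ : 'I_1 => complete kappa)).
  apply: ramsey_le R0 _; apply: (arrows_cat_merge j0) arrR.
  by have [] := ramseyP (fun j => complete (n j)).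
rewrite addn1 ltnNge; apply/negP => leR.
have [R0 arrR] := ramseyP (cat_graphs G (fun j => complete (n j))).
(* Ramsey numbers are positive, so the assumed bound forces both factors to be positive. This
   excludes [gamma = 1] and [kappa = 1], where no extremal coloring on a positive number of vertices
   is available. *)
have := leq_trans R0 leR; rewrite muln_gt0 => /andP[gamma1 kappa1].
have [gamma0 _] := ramseyP G.
have [kappa0 _] := ramseyP (fun j => complete (n j)).
move: arrR; apply/negP; apply: (not_arrows_cat_blowup i0 j0 hG _ _ leR).
  by apply: not_arrows_lt_ramsey; rewrite // subn1 prednK.
by apply: not_arrows_lt_ramsey; rewrite // subn1 prednK.
Qed.
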